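(* Let $m,n\ge 1$ be integers. The number of maximum nonattacking arrangements of pawns on a $2n\times 2m$ chessboard is $\binom{m+n}{n}^2$.
   Context: A $p\times q$ chessboard is the grid of cells $(r,c)$ with $1\le r\le p$ (rows, numbered from top to bottom) and $1\le c\le q$ (columns, numbered from left to right). An arrangement of pawns is a set of cells, namely those occupied by a pawn (at most one pawn per cell, pawns indistinguishable). All pawns face the same vertical direction, and a pawn attacks the (at most two) cells diagonally adjacent to it in the neighbouring row it faces. An arrangement is nonattacking (independent) if no pawn attacks a cell occupied by another pawn; equivalently, no two occupied cells $(r,c),(r',c')$ satisfy $|r-r'|=|c-c'|=1$. A maximum nonattacking arrangement is a nonattacking arrangement with the largest possible number of pawns among all nonattacking arrangements on the given board. Arrangements are counted as subsets of cells; arrangements differing by a symmetry of the board are counted as different. *)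

(* Defs.v *)
From mathcomp Require Import all_boot all_order all_algebra zify.

Set Implicit Arguments.
Unset Strict Implicit.
Unset Printing Implicit Defensive.

Import IntDist.

(* Cell (r, c): row r from the top, column c from the left, both 0-based. *)
Definition cell (p q : nat) : finType := ('I_p * 'I_q)%type.

(* The common direction is taken to be upwards; nonattackingP below shows that
   the resulting notion of independence does not depend on this choice. *)
Definition pawn_attacks (p q : nat) (x y : cell p q) : bool :=
  ((y.1).+1 == x.1 :> nat) &&
  (((y.2).+1 == x.2 :> nat) || ((x.2).+1 == y.2 :> nat)).

Definition nonattacking (p q : nat) (A : {set cell p q}) : bool :=
  [forall x in A, forall y in A, ~~ pawn_attacks x y].

(* Maximum in cardinality, not merely for inclusion. *)
Definition max_nonattacking (p q : nat) (A : {set cell p q}) : bool :=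
  nonattacking A &&
  [forall B : {set cell p q}, nonattacking B ==> (#|B| <= #|A|)].

Lemma nonattackingP (p q : nat) (A : {set cell p q}) :
  reflect (forall x y : cell p q, x \in A -> y \in A ->
             ~ (`|x.1 - y.1|%N = 1 /\ `|x.2 - y.2|%N = 1))
          (nonattacking A).
Proof.
apply: (iffP forall_inP) => [H x y xA yA [d1 d2]|H x xA].
  have /forall_inP/(_ y yA) := H x xA; have /forall_inP/(_ x xA) := H y yA.
  rewrite /pawn_attacks; lia.
apply/forall_inP => y yA; apply/negP => /andP[/eqP h1 h2].
by apply: (H x y xA yA); split; lia.
Qed.

(* Main.v *)
Require Import Defs.
From mathcomp Require Import all_boot zify.

Set Implicit Arguments.
Unset Strict Implicit.
Unset Printing Implicit Defensive.

(** Pawns on the two squares of a diagonal of a 2 x 2 block attack each other.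
    Cut the board into n * m blocks, hence into 2 * n * m diagonals: a
    nonattacking arrangement has at most one pawn on each of them, and filling
    every other row puts one on each.  So the maximum arrangements are the
    nonattacking ones that choose, on each diagonal, either its upper or its
    lower square.

    The two families of diagonals (falling and rising) lie on squares of
    opposite colours, so they do not interact, and mirroring the columns
    exchanges them.  Within the rising family, the lower square of block (i, j)
    is in conflict, outside its own block, exactly with the upper squares of the
    blocks (i + 1, j), (i, j - 1) and (i + 1, j - 1).  Nonattacking choices are
    thus the n x m boolean matrices (true standing for lower) in which the value
    true spreads downwards and leftwards ([nonattacking_fill]): row i is true on
    its first k_i entries, for a weakly increasing sequence
    k_0 <= ... <= k_(n-1) of integers in [0, m] ([monotone_staircase]).  There
    are C(m + n, n) such sequences, and one is chosen for each of the two
    families. *)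

(** * Diagonals of the 2 x 2 blocks *)

(** The diagonals of the blocks: block row, block column, and family.  In the
    family true, block columns are counted from the right, so that both
    families are governed by the same rules. *)
Definition diagonal (n m : nat) : finType := ('I_n * 'I_m * bool)%type.

Section Board.

Variables n m : nat.
Implicit Types (b : diagonal n m) (l d : bool) (A : {set cell (2 * n) (2 * m)})
  (f : diagonal n m -> bool) (s : {ffun bool -> n.-tuple 'I_m.+1}).

Lemma diagonal_row_subproof (i : 'I_n) l : 2 * i + l < 2 * n.
Proof. by case: i l => i ltin [] /=; lia. Qed.

Lemma diagonal_col_subproof (j : 'I_m) l : 2 * j + ~~ l < 2 * m.
Proof. by case: j l => j ltjm [] /=; lia. Qed.

(** The lower (l = true) or upper square of a diagonal.  A rising diagonal has
    its lower square on the left; a falling one is a mirrored rising one. *)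
Definition square b l : cell (2 * n) (2 * m) :=
  let: (i, j, d) := b in
  let c := Ordinal (diagonal_col_subproof j l) in
  (Ordinal (diagonal_row_subproof i l), if d then rev_ord c else c).

Lemma square_inj b b' l l' : square b l = square b' l' -> b = b' /\ l = l'.
Proof.
case: b b' => [[i j] d] [[i' j'] d'] /= [].
move: (ltn_ord j) (ltn_ord j') => hj hj' er /(congr1 val) ec.
have [ei el] : i = i' :> nat /\ l = l'.
  by case: l l' er {ec} => [] [] /=; lia.
have [ej ed] : j = j' :> nat /\ d = d'.
  by move: ec; rewrite -el; case: l d d' {er el} => [] [] [] /=; lia.
by rewrite (ord_inj ei) (ord_inj ej) ed el.
Qed.

Lemma square_surj x : exists b l, x = square b l.
Proof.
case: x => r c.
have hr : r./2 < n by move: (ltn_ord r); lia.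
pose d := odd r == odd c; pose c' := if d then rev_ord c else c.
have hc : c'./2 < m by move: (ltn_ord c'); lia.
exists (Ordinal hr, Ordinal hc, d), (odd r).
have ec : c' = Ordinal (diagonal_col_subproof (Ordinal hc) (odd r)).
  apply: val_inj => /=; move: (ltn_ord c); rewrite /c' /d.
  by case: (boolP (odd r == odd c)) => /= h; lia.
congr (_, _); first by apply: val_inj => /=; lia.
by rewrite /= -ec /c'; case: (d); rewrite ?rev_ordK.
Qed.

Definition fill (f : diagonal n m -> bool) : {set cell (2 * n) (2 * m)} :=
  [set square b (f b) | b : diagonal n m].

Lemma mem_fill f b l : (square b l \in fill f) = (l == f b).
Proof.
apply/imsetP/eqP => [[b' _ /square_inj[<- ->]] | ->] //.
by exists b.
Qed.

Lemma card_fill f : #|fill f| = n * m * 2.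
Proof.
rewrite card_imset; last by move=> b b' /square_inj[].
by rewrite !card_prod !card_ord card_bool.
Qed.

Lemma square_attack b : pawn_attacks (square b true) (square b false).
Proof.
case: b => [[i j] d]; have := ltn_ord j.
by rewrite /pawn_attacks /=; case: d => /=; lia.
Qed.

(** As the two squares of a diagonal attack each other, A has at most one pawn
    on each. *)
Lemma nonattacking_sub_fill A :
  nonattacking A -> A \subset fill (fun b => square b true \in A).
Proof.
move=> nA; apply/subsetP => x; have [b [l ->]] := square_surj x.
rewrite mem_fill; case: l => [->|lo] //.
apply/eqP/esym/negP => hi.
have /forall_inP/(_ _ lo) := forall_inP nA _ hi.
by rewrite square_attack.
Qed.

(** * Nonattacking choices are monotone matrices *)

(** Only adjacent blocks are compared, because attacks join adjacent blocks;
    the comparison of distant blocks follows by iteration. *)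
Definition monotone (f : diagonal n m -> bool) :=
  (forall (i i' : 'I_n) j d, i' = i.+1 :> nat -> f (i, j, d) -> f (i', j, d)) /\
  (forall i (j j' : 'I_m) d, j = j'.+1 :> nat -> f (i, j, d) -> f (i, j', d)).

(** An attack between different diagonals joins the lower square of one to the
    upper square of a neighbour of the same family, below it, to its left
    (its right in the mirrored family), or both; the last case combines the first two. *)
Lemma nonattacking_fill f : nonattacking (fill f) <-> monotone f.
Proof.
split=> [nf | [fi fj]].
  split=> [i i' j d ei | i j j' d ej] fb; apply: contraT => nfb.
  - have hi : square (i, j, d) true \in fill f by rewrite mem_fill fb.
    have lo : square (i', j, d) false \in fill f.
      by rewrite mem_fill (negbTE nfb).
    have /forall_inP/(_ _ hi) := forall_inP nf _ lo.
    rewrite /pawn_attacks /= ei; have := ltn_ord j.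
    by case: d {fb nfb hi lo} => /=; lia.
  - have hi : square (i, j, d) true \in fill f by rewrite mem_fill fb.
    have lo : square (i, j', d) false \in fill f.
      by rewrite mem_fill (negbTE nfb).
    have /forall_inP/(_ _ lo) := forall_inP nf _ hi.
    rewrite /pawn_attacks /=; have := ltn_ord j.
    by case: d {fb nfb hi lo} => /=; lia.
apply/forall_inP => x; have [[[i j] d] [l ->]] := square_surj x.
rewrite mem_fill => /eqP el.
apply/forall_inP => y; have [[[i' j'] d'] [l' ->]] := square_surj y.
rewrite mem_fill => /eqP el'; apply/negP; rewrite /pawn_attacks /=.
move=> /andP[/eqP er ec].
have ed : d' = d.
  move: ec (ltn_ord j) (ltn_ord j') er {el el'}.
  by case: d d' l l' => [] [] [] [] /=; lia.
rewrite {}ed in el' ec.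
case: l el ec er => el ec er; case: l' el' ec er => el' ec er.
- by move: er; rewrite /=; lia.
- have ei : i = i' by apply: val_inj; move: er => /=; lia.
  rewrite {}ei in el er.
  have [ej | ej] : j = j' :> nat \/ j = j'.+1 :> nat.
    by move: ec (ltn_ord j) (ltn_ord j'); case: (d) => /=; lia.
  + by move: el; rewrite (ord_inj ej) -el'.
  + by move: (fj i' _ _ d ej); rewrite -el -el' => /(_ isT).
- have ei : i = i'.+1 :> nat by move: er => /=; lia.
  have := fi _ _ j' d ei; rewrite -el' => /(_ isT) fij'.
  have [ej | ej] : j = j' :> nat \/ j' = j.+1 :> nat.
    by move: ec (ltn_ord j) (ltn_ord j'); case: (d) => /=; lia.
  + by move: el; rewrite (ord_inj ej) fij'.
  + by move: (fj i _ _ d ej fij'); rewrite -el.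
- by move: er; rewrite /=; lia.
Qed.

(** The bound n * m * 2 comes from [nonattacking_sub_fill] and is attained, so
    being of maximum size means being of this size. *)
Lemma max_nonattackingE A :
  max_nonattacking A = nonattacking A && (#|A| == n * m * 2).
Proof.
rewrite /max_nonattacking; case nA: (nonattacking A) => //=.
have ub (B : {set cell (2 * n) (2 * m)}) : nonattacking B -> #|B| <= n * m * 2.
  by move=> /nonattacking_sub_fill/subset_leq_card; rewrite card_fill.
apply/forallP/eqP => [maxA | cA B]; last by apply/implyP; rewrite cA; apply: ub.
(* choosing every lower square fills the odd rows *)
have nF : nonattacking (fill (fun=> true)) by apply/nonattacking_fill.
apply/eqP; rewrite eqn_leq ub //=.
by have := implyP (maxA _) nF; rewrite card_fill.
Qed.

(** * Monotone matrices are pairs of weakly increasing sequences *)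

(** The threshold is the least j outside P, or m if P holds everywhere. *)
Lemma down_closed_threshold (P : pred 'I_m) :
  (forall j j' : 'I_m, j = j'.+1 :> nat -> P j -> P j') ->
  exists k : 'I_m.+1, forall j : 'I_m, P j = (j < k).
Proof.
move=> closedP; case: (pickP [pred j | ~~ P j]) => [j0 /= nPj0 | allP].
  case: (@arg_minnP _ j0 (fun j => ~~ P j) val nPj0) => k /= nPk min_k.
  exists (widen_ord (leqnSn m) k) => j /=.
  case: ltnP => [ltjk | lekj].
    by apply: contraTT ltjk => /min_k; rewrite -leqNgt.
  have [e ej] : exists e, j = k + e :> nat by exists (j - k); lia.
  elim: e j {lekj} ej => [|e IHe] j ej.
    by rewrite (ord_inj (etrans ej (addn0 k))) (negbTE nPk).
  have lt : k + e < m by have := ltn_ord j; lia.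
  have ej' : j = (Ordinal lt).+1 :> nat by rewrite ej addnS.
  by apply/negP => /(closedP _ _ ej'); rewrite IHe.
exists ord_max => j /=; rewrite ltn_ord.
by apply/idPn => nPj; have := allP j; rewrite /= nPj.
Qed.

Lemma threshold_inj (k k' : 'I_m.+1) :
  (forall j : 'I_m, (j < k) = (j < k')) -> k = k'.
Proof.
move=> eqkk'; apply: val_inj; move: (ltn_ord k) (ltn_ord k') => hk hk'.
case: (ltngtP k k') => // [lt | lt].
- have h : k < m by lia.
  by have := eqkk' (Ordinal h); rewrite /= ltnn lt.
- have h : k' < m by lia.
  by have := eqkk' (Ordinal h); rewrite /= ltnn lt.
Qed.

Definition row_lengths : {set n.-tuple 'I_m.+1} :=
  [set t : n.-tuple 'I_m.+1 | sorted leq (map val t)].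

Lemma row_lengthsP (t : n.-tuple 'I_m.+1) :
  reflect (forall i i' : 'I_n, i' = i.+1 :> nat -> tnth t i <= tnth t i')
          (t \in row_lengths).
Proof.
rewrite inE; have nthE (i : 'I_n) : nth 0 (map val t) i = tnth t i.
  by rewrite (nth_map ord0) ?size_tuple // -tnth_nth.
apply: (iffP (sortedP 0)) => [st i i' ei | st i].
  by rewrite -!nthE ei; apply: st; rewrite size_map size_tuple -ei.
rewrite size_map size_tuple => lt.
have := st (Ordinal (ltnW lt)) (Ordinal lt) erefl.
by rewrite -!nthE.
Qed.

Definition staircase (s : {ffun bool -> n.-tuple 'I_m.+1}) b : bool :=
  let: (i, j, d) := b in j < tnth (s d) i.

Lemma staircase_inj s s' : staircase s =1 staircase s' -> s = s'.
Proof.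
move=> eqss'; apply/ffunP => d; apply: eq_from_tnth => i.
by apply: threshold_inj => j; apply: (eqss' (i, j, d)).
Qed.

Lemma staircase_monotone s :
  (forall d, s d \in row_lengths) -> monotone (staircase s).
Proof.
move=> ss; split=> [i i' j d ei | i j j' d ej] /=; last by lia.
by move=> /leq_trans; apply; apply: (row_lengthsP _ (ss d)).
Qed.

(** Spreading along rows gives each row a threshold; spreading from one row to
    the next makes the thresholds weakly increasing. *)
Lemma monotone_staircase f : monotone f ->
  exists2 s : {ffun bool -> n.-tuple 'I_m.+1},
    forall d, s d \in row_lengths & f =1 staircase s.
Proof.
case=> fi fj.
have /fin_all_exists[k kE] (x : bool * 'I_n) :
    exists k : 'I_m.+1, forall j, f (x.2, j, x.1) = (j < k).
  by apply: down_closed_threshold => j j'; apply: fj.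
exists [ffun d => [tuple k (d, i) | i < n]] => [d | [[i j] d]]; last first.
  by rewrite /= ffunE tnth_mktuple -(kE (d, i)).
rewrite ffunE; apply/row_lengthsP => i i' ei; rewrite !tnth_mktuple leqNgt.
apply/negP => lt; have h : k (d, i') < m by apply: leq_trans lt (leq_ord _).
have := fi i i' (Ordinal h) d ei.
by rewrite (kE (d, i)) (kE (d, i')) /= ltnn lt => /(_ isT).
Qed.

(** A maximum arrangement is contained in a fill of the same size, hence equal
    to it, and its choice of squares is then a staircase in each family. *)
Lemma max_nonattacking_staircases :
  [set A | max_nonattacking A] =
  [set fill (staircase s) | s in ffun_on (mem row_lengths)].
Proof.
apply/setP => A; rewrite inE max_nonattackingE.
apply/andP/imsetP => [[nA /eqP cA] | [s /ffun_onP ss ->]]; last first.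
  by rewrite card_fill; split=> //; apply/nonattacking_fill/staircase_monotone.
have eqA : A = fill (fun b => square b true \in A).
  by apply/eqP; rewrite eqEcard nonattacking_sub_fill // card_fill cA leqnn.
have [|s ss fE] := @monotone_staircase (fun b => square b true \in A).
  by apply/nonattacking_fill; rewrite -eqA.
exists s; first exact/ffun_onP.
by rewrite {1}eqA; apply: eq_imset => b; rewrite fE.
Qed.

End Board.

Theorem theorem2p10 (m n : nat) (hm : 1 <= m) (hn : 1 <= n) :
  #|[set A : {set cell (2 * n) (2 * m)} | max_nonattacking A]| = 'C(m + n, n) ^ 2.
Proof.
rewrite max_nonattacking_staircases card_imset => [|s s' eqss'].
  by rewrite card_ffun_on card_bool card_sorted_tuples addnC.
apply: staircase_inj => b; apply/eqP.
by rewrite -mem_fill -eqss' mem_fill.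
Qed.
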